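(* Let $L$ be a real $3$-dimensional Lie algebra. Then $L$ is isomorphic to exactly one of the following Lie algebras $(\mathbb{R}^3,[\cdot,\cdot])$, where $(e_1,e_2,e_3)$ is the canonical basis of $\mathbb{R}^3$ and the Lie bracket is the skew-symmetric bilinear map determined by: \begin{itemize} \item Bianchi $I$: $[e_1,e_2]=[e_2,e_3]=[e_3,e_1]=0$; \item Bianchi $II$: $[e_1,e_2]=0,\ [e_2,e_3]=e_1,\ [e_3,e_1]=0$; \item Bianchi $IV$: $[e_1,e_2]=0,\ [e_2,e_3]=e_1-e_2,\ [e_3,e_1]=e_1$; \item Bianchi $V$: $[e_1,e_2]=0,\ [e_2,e_3]=-e_2,\ [e_3,e_1]=e_1$; \item Bianchi $VI_h$ (one for each real $h\le 0$): $[e_1,e_2]=0,\ [e_2,e_3]=e_1-he_2,\ [e_3,e_1]=he_1-e_2$; \item Bianchi $VII_h$ (one for each real $h\ge 0$): $[e_1,e_2]=0,\ [e_2,e_3]=e_1-he_2,\ [e_3,e_1]=he_1+e_2$; \item Bianchi $VIII$: $[e_1,e_2]=-e_3,\ [e_2,e_3]=e_1,\ [e_3,e_1]=e_2$; \item Bianchi $IX$: $[e_1,e_2]=e_3,\ [e_2,e_3]=e_1,\ [e_3,e_1]=e_2$. \end{itemize}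
   Context: In the two series, different values of the parameter $h$ count as different members of the list, so ''exactly one'' includes that the algebras with different parameters are pairwise non-isomorphic. *)

(* Defs.v *)
From HB Require Import structures.
From mathcomp Require Import all_boot all_order all_algebra.
From mathcomp Require Import ring.
From mathcomp Require Import reals.

Set Implicit Arguments.
Unset Strict Implicit.
Unset Printing Implicit Defensive.

Import Order.TTheory GRing.Theory Num.Theory.
Local Open Scope ring_scope.

HB.mixin Record Lmodule_isLieAlgebra (R : comNzRingType) L
    of GRing.Lmodule R L := {
  lie : L -> L -> L;
  lie_linearl : forall y, linear (lie^~ y);
  lie_linearr : forall x, linear (lie x);
  liexx : forall x, lie x x = 0;
  lie_jacobi : forall x y z,
    lie x (lie y z) + lie y (lie z x) + lie z (lie x y) = 0
}.

#[short(type="lieAlgebraType")]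
HB.structure Definition LieAlgebra (R : comNzRingType) :=
  {L of Lmodule_isLieAlgebra R L & GRing.Lmodule R L}.

#[short(type="lieVectType")]
HB.structure Definition LieVect (R : comNzRingType) :=
  {L of LieAlgebra R L & Vector R L}.

Definition lie_isomorphic (R : comNzRingType) (L M : lieAlgebraType R) : Prop :=
  exists f : {linear L -> M},
    bijective f /\ {morph f : x y / lie x y >-> lie x y}.

Section Skew3.
Variable R : comNzRingType.

Definition e1 : 'rV[R]_3 := delta_mx 0 0.
Definition e2 : 'rV[R]_3 := delta_mx 0 1.
Definition e3 : 'rV[R]_3 := delta_mx 0 2.

(* The skew-symmetric bilinear map on R^3 sending (e1, e2), (e2, e3), (e3, e1)
   to a, b, c respectively; see skew3_e12, skew3_e23, skew3_e31. *)
Definition skew3 (a b c x y : 'rV[R]_3) : 'rV[R]_3 :=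
  (x 0 0 * y 0 1 - x 0 1 * y 0 0) *: a +
  (x 0 1 * y 0 2 - x 0 2 * y 0 1) *: b +
  (x 0 2 * y 0 0 - x 0 0 * y 0 2) *: c.

Lemma skew3_e12 a b c : skew3 a b c e1 e2 = a.
Proof.
by rewrite /skew3 !mxE /= !(mulr0, mul0r, mulr1, oppr0, scale0r, scale1r, addr0).
Qed.

Lemma skew3_e23 a b c : skew3 a b c e2 e3 = b.
Proof.
rewrite /skew3 !mxE /=.
by rewrite !(mulr0, mul0r, mulr1, oppr0, scale0r, scale1r, addr0, add0r).
Qed.

Lemma skew3_e31 a b c : skew3 a b c e3 e1 = c.
Proof.
rewrite /skew3 !mxE /=.
by rewrite !(mulr0, mul0r, mulr1, oppr0, scale0r, scale1r, addr0, add0r).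
Qed.

Lemma skew3_linearl a b c y : linear ((skew3 a b c)^~ y).
Proof.
move=> k x z; apply/rowP=> j; rewrite !mxE.
move: (a 0 j) (b 0 j) (c 0 j) (x 0 0) (x 0 1) (x 0 2) (y 0 0) (y 0 1) (y 0 2).
move: (z 0 0) (z 0 1) (z 0 2) => *; ring.
Qed.

Lemma skew3xx a b c x : skew3 a b c x x = 0.
Proof.
by rewrite /skew3 [x 0 1 * _]mulrC [x 0 2 * x 0 1]mulrC [x 0 2 * _]mulrC !subrr
  !scale0r !addr0.
Qed.

Lemma skew3C a b c x y : skew3 a b c x y = - skew3 a b c y x.
Proof.
apply/rowP=> j; rewrite !mxE.
move: (a 0 j) (b 0 j) (c 0 j) (x 0 0) (x 0 1) (x 0 2) (y 0 0) (y 0 1) (y 0 2).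
by move=> *; ring.
Qed.

Lemma skew3_linearr a b c x : linear (skew3 a b c x).
Proof.
move=> k y z; rewrite skew3C skew3_linearl opprD -scalerN.
by rewrite -!(skew3C _ _ _ x).
Qed.

(* The Jacobiator is alternating, so it is enough to check e1, e2, e3. *)
Lemma skew3_jacobi a b c :
  let sk := skew3 a b c in
  sk e1 b + sk e2 c + sk e3 a = 0 ->
  forall x y z, sk x (sk y z) + sk y (sk z x) + sk z (sk x y) = 0.
Proof.
move=> /= /rowP J x y z; apply/rowP=> j.
pose d := x 0 0 * (y 0 1 * z 0 2 - y 0 2 * z 0 1)
        - x 0 1 * (y 0 0 * z 0 2 - y 0 2 * z 0 0)
        + x 0 2 * (y 0 0 * z 0 1 - y 0 1 * z 0 0).
transitivity (d * (skew3 a b c e1 b + skew3 a b c e2 c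
                   + skew3 a b c e3 a) 0 j); last by rewrite J mxE mulr0.
rewrite /d !mxE /=.
move: (x 0 0) (x 0 1) (x 0 2) (y 0 0) (y 0 1) (y 0 2) (z 0 0) (z 0 1) (z 0 2).
move: (a 0 j) (b 0 j) (c 0 j) (a 0 0) (a 0 1) (a 0 2) (b 0 0) (b 0 1) (b 0 2).
move: (c 0 0) (c 0 1) (c 0 2) => *.
ring.
Qed.

End Skew3.

Arguments e1 {R}.
Arguments e2 {R}.
Arguments e3 {R}.

(* There is no type III: it is VI_h with h = -1. Equality of two types of the
   same series amounts to equality of their parameters, since the proofs of
   the (boolean) sign conditions are unique. *)
Inductive bianchi_type (R : realType) : Type :=
| BianchiI
| BianchiII
| BianchiIV
| BianchiV
| BianchiVI (h : R) of h <= 0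
| BianchiVII (h : R) of 0 <= h
| BianchiVIII
| BianchiIX.

Definition bianchi_bracket (R : realType) (t : bianchi_type R) :
    'rV[R]_3 -> 'rV[R]_3 -> 'rV[R]_3 :=
  match t with
  | BianchiI       => skew3 0 0 0
  | BianchiII      => skew3 0 e1 0
  | BianchiIV      => skew3 0 (e1 - e2) e1
  | BianchiV       => skew3 0 (- e2) e1
  | BianchiVI h _  => skew3 0 (e1 - h *: e2) (h *: e1 - e2)
  | BianchiVII h _ => skew3 0 (e1 - h *: e2) (h *: e1 + e2)
  | BianchiVIII    => skew3 (- e3) e1 e2
  | BianchiIX      => skew3 e3 e1 e2
  end.

Lemma bianchi_linearl (R : realType) (t : bianchi_type R) y :
  linear ((bianchi_bracket t)^~ y).
Proof. by case: t => *; apply: skew3_linearl. Qed.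

Lemma bianchi_linearr (R : realType) (t : bianchi_type R) x :
  linear (bianchi_bracket t x).
Proof. by case: t => *; apply: skew3_linearr. Qed.

Lemma bianchixx (R : realType) (t : bianchi_type R) x :
  bianchi_bracket t x x = 0.
Proof. by case: t => *; apply: skew3xx. Qed.

Lemma bianchi_jacobi (R : realType) (t : bianchi_type R) x y z :
  bianchi_bracket t x (bianchi_bracket t y z) +
  bianchi_bracket t y (bianchi_bracket t z x) +
  bianchi_bracket t z (bianchi_bracket t x y) = 0.
Proof.
case: t => [||||h _|h _||] /=; apply: skew3_jacobi; apply/rowP=> j;
  rewrite !mxE /=; ring.
Qed.

(* R^3 with the bracket of type t *)
Definition bianchi (R : realType) (t : bianchi_type R) : Type := 'rV[R]_3.

HB.instance Definition _ (R : realType) (t : bianchi_type R) :=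
  Vector.copy (bianchi t) 'rV[R]_3.
HB.instance Definition _ (R : realType) (t : bianchi_type R) :=
  Lmodule_isLieAlgebra.Build R (bianchi t)
    (bianchi_linearl t) (bianchi_linearr t) (bianchixx t) (bianchi_jacobi t).

(* Main.v *)
From HB Require Import structures.
Require Import Defs.
From mathcomp Require Import all_boot all_order all_algebra.
From mathcomp Require Import ring lra.
From mathcomp Require Import reals.

(* Identify the Lie algebra with R^3. Since the cross product identifies
   Lambda^2 R^3 with R^3, its bracket is [x, y] = (x \times y) M for a 3x3 matrix M, and since
   (xP \times yP) P^T = det P (x \times y), isomorphism amounts to
   P^T M P = det P N; replacing P by sP turns this into congruence up to an
   arbitrary nonzero factor. The Jacobi identity says that w M = 0, where w is
   the axial vector of the skew part of M. If w = 0 then M is symmetric and can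
   be diagonalized; if not, taking w as third basis vector leaves a 2x2 block,
   whose symmetric part can be diagonalized. Rescaling then gives the list.
   The types are told apart by the ranks of the symmetric and skew parts, by
   definiteness (VIII and IX), and for VI_h and VII_h by the determinants of the
   symmetric and skew parts of the 2x2 block, since congruence multiplies both
   by the same positive factor. *)

Set Implicit Arguments.
Unset Strict Implicit.
Unset Printing Implicit Defensive.

Import Order.TTheory GRing.Theory Num.Theory.
Local Open Scope ring_scope.

(** * Algebra in dimension three: determinants, cross products, axial vectors *)

Lemma forall_ord3 (P : 'I_3 -> Prop) : P 0 -> P 1 -> P 2 -> forall i, P i.
Proof.
by move=> P0 P1 P2 [[|[|[|//]]] lti]; [move: P0|move: P1|move: P2];
  congr P; apply: val_inj.
Qed.

Lemma sum_ord3 (V : nmodType) (F : 'I_3 -> V) : \sum_i F i = F 0 + F 1 + F 2.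
Proof.
rewrite !big_ord_recl big_ord0 addr0 addrA.
by congr (F _ + F _ + F _); apply: val_inj.
Qed.

Section ThreeByThree.
Variable R : comNzRingType.

Definition mx3 (a b c d e f g h i : R) : 'M[R]_3 :=
  \matrix_(j, k)
    nth 0 (nth [::] [:: [:: a; b; c]; [:: d; e; f]; [:: g; h; i]] j) k.

Lemma det_mx3 (M : 'M[R]_3) :
  \det M = M 0 0 * (M 1 1 * M 2 2 - M 1 2 * M 2 1)
         - M 0 1 * (M 1 0 * M 2 2 - M 1 2 * M 2 0)
         + M 0 2 * (M 1 0 * M 2 1 - M 1 1 * M 2 0).
Proof.
(* Entries indexed by naturals let the index arithmetic of the cofactor expansion reduce to the
   numeral equations [E]. *)
have [f ->] : exists f : nat -> nat -> R, M = \matrix_(i, j) f i j.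
  by exists (fun a b => M (inord a) (inord b)); apply/matrixP => i j;
    rewrite mxE !inord_val.
do ![rewrite (expand_det_row _ ord0) /cofactor !big_ord_recl !big_ord0].
have E : ((1 %% 3 = 1)%N * ((1 + 1) %% 3 = 2)%N * (bump 0 0 = 1%N) *
    (bump 0 1 = 2%N) * (bump 1 0 = 0%N) * (bump 1 1 = 2%N) *
    (bump 2 0 = 0%N) * (bump 2 1 = 1%N))%type by [].
by rewrite !det_mx00 !mxE /= !E; ring.
Qed.

Definition cross : 'rV[R]_3 -> 'rV[R]_3 -> 'rV[R]_3 := skew3 e3 e1 e2.

(* Twice the vector of the skew part of M. *)
Definition axial (M : 'M[R]_3) : 'rV[R]_3 :=
  (M 1 2 - M 2 1) *: e1 + (M 2 0 - M 0 2) *: e2 + (M 0 1 - M 1 0) *: e3.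

(** Because e1 x e2 = [e3] and cyclically, the images of the three basic brackets are the rows of
    [M] in the order 2, 0, 1. *)
Lemma skew3_cross (M : 'M[R]_3) x y :
  skew3 (row 2 M) (row 0 M) (row 1 M) x y = cross x y *m M.
Proof.
apply/rowP=> j; rewrite /cross /skew3 !mxE sum_ord3 !mxE /=; ring.
Qed.

Lemma cross_mulmx (P : 'M[R]_3) x y :
  cross (x *m P) (y *m P) *m P^T = \det P *: cross x y.
Proof.
rewrite det_mx3; apply/rowP; elim/forall_ord3;
  rewrite !(mxE, sum_ord3) /=; ring.
Qed.

(** In this form the axial vector appears in the Jacobi identity for the canonical basis. *)
Lemma axial_cross (M : 'M[R]_3) :
  axial M = cross e1 (e1 *m M) + cross e2 (e2 *m M) + cross e3 (e3 *m M).
Proof.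
rewrite /e1 /e2 /e3 -!rowE.
apply/rowP; elim/forall_ord3; rewrite !(mxE, sum_ord3) /=; ring.
Qed.

(** The skew matrix [M - M^T] sends a column v to v x w, where w is the axial vector, so it kills
    w. *)
Lemma axial_skew (M : 'M[R]_3) : M *m (axial M)^T = M^T *m (axial M)^T.
Proof.
apply/colP; elim/forall_ord3; rewrite !(mxE, sum_ord3) /=; ring.
Qed.

Lemma axial_eq0 (M : 'M[R]_3) : (axial M == 0) = (M^T == M).
Proof.
apply/eqP/eqP => [/rowP w0|MT].
  have := (w0 0, w0 1, w0 2); rewrite !mxE /= => -[[]].
  rewrite !(mulr0, mulr1, addr0, add0r).
  move=> /subr0_eq E1 /subr0_eq E2 /subr0_eq E3.
  by apply/matrixP; do 2![elim/forall_ord3]; rewrite !mxE ?E1 ?E2 ?E3.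
have E i j : M i j = M j i by rewrite -{1}MT mxE.
by rewrite /axial (E 2 1) (E 0 2) (E 1 0) !subrr !scale0r !addr0.
Qed.

End ThreeByThree.

(** * Elementary rules for Lie brackets *)

Section LieTheory.
Variables (R : comNzRingType) (L : lieAlgebraType R).
Implicit Types u v w : L.

Lemma lieDl u v w : lie (u + v) w = lie u w + lie v w.
Proof. by have := lie_linearl w 1 u v; rewrite !scale1r. Qed.

Lemma lieDr u v w : lie w (u + v) = lie w u + lie w v.
Proof. by have := lie_linearr w 1 u v; rewrite !scale1r. Qed.

Lemma lieC u v : lie u v = - lie v u.
Proof.
apply/eqP; rewrite -addr_eq0; have := liexx (u + v).
by rewrite lieDl !lieDr !liexx add0r addr0 => ->.
Qed.

Lemma lie0l u : lie 0 u = 0.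
Proof. by apply: (addrI (lie 0 u)); rewrite -lieDl !addr0. Qed.

Lemma lieZl a u v : lie (a *: u) v = a *: lie u v.
Proof. by have := lie_linearl v a u 0; rewrite lie0l !addr0. Qed.

Lemma lieZr a u v : lie u (a *: v) = a *: lie u v.
Proof. by rewrite lieC lieZl -scalerN -lieC. Qed.

End LieTheory.

(** * Structure matrices of a Lie algebra and their change of basis *)

Definition has_structure (R : comNzRingType) (L : lieAlgebraType R)
    (M : 'M[R]_3) : Prop :=
  exists f : {linear L -> 'rV[R]_3},
    bijective f /\ forall u v, f (lie u v) = cross (f u) (f v) *m M.

(* The factor c is harmless in dimension 3: scaling P by s multiplies P^T M P by
   s^2 but det P by s^3, so that c can be made equal to det P. *)
Definition congruent (F : fieldType) n (M N : 'M[F]_n) : Prop :=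
  exists P c, [/\ P \in unitmx, c != 0 & P^T *m M *m P = c *: N].

Section Structure.
Variable F : fieldType.
Implicit Types M N P : 'M[F]_3.

Lemma exists_structure (L : lieVectType F) :
  \dim {:L} = 3%N -> exists M, has_structure L M.
Proof.
move=> dimL; have [X XP] : exists X : 3.-tuple L, basis_of {:L} X.
  by rewrite -dimL; exists (vbasis {:L}); apply: vbasisP.
pose f (u : L) := \row_i coord X i u.
have f_lin : linear f by move=> a u v; apply/rowP => i; rewrite !mxE linearP.
pose fL := GRing.isLinear.Build _ _ _ _ f f_lin.
pose g : {linear L -> 'rV[F]_3} := HB.pack f fL.
exists (\matrix_(i < 3) nth 0 [:: f (lie X`_1 X`_2); f (lie X`_2 X`_0);
                                  f (lie X`_0 X`_1)] i).
exists g; split.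
  exists (fun x : 'rV_3 => \sum_i x 0 i *: X`_i) => [u|x].
    rewrite [RHS](coord_basis XP (memvf u)).
    by apply: eq_bigr => i _; rewrite mxE.
  by apply/rowP => i; rewrite mxE coord_sum_free ?(basis_free XP).
move=> u v; rewrite -skew3_cross !rowK /= /skew3.
have uE w : w = coord X 0 w *: X`_0 + coord X 1 w *: X`_1 + coord X 2 w *: X`_2.
  by rewrite {1}(coord_basis XP (memvf w)) sum_ord3.
rewrite {1}(uE u) {1}(uE v) !mxE !(lieDl, lieDr, lieZl, lieZr, liexx).
rewrite (lieC X`_1 X`_0) (lieC X`_2 X`_1) (lieC X`_0 X`_2).
rewrite -[f]/(g : L -> 'rV_3) !(linearD, linearZ, linearN, linear0) /=.
move: (f (lie X`_0 _)) (f (lie X`_1 _)) (f (lie X`_2 _)) => a b c.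
by apply/rowP => j; rewrite !mxE; ring.
Qed.

Lemma axial_structure (L : lieAlgebraType F) M :
  has_structure L M -> axial M *m M = 0.
Proof.
case=> f [[g fK gK] fM].
have J x y z : cross x (cross y z *m M) *m M + cross y (cross z x *m M) *m M
    + cross z (cross x y *m M) *m M = 0.
  have := congr1 f (lie_jacobi (g x) (g y) (g z)).
  by rewrite !linearD linear0 !fM !gK.
(* On the canonical basis the inner cross products are again basis vectors. *)
have := J e1 e2 e3; rewrite {2 4 6}/cross skew3_e12 skew3_e23 skew3_e31.
by rewrite -!mulmxDl -axial_cross.
Qed.

Lemma structure_congruent (L : lieAlgebraType F) M N :
  has_structure L M -> congruent M N -> has_structure L N.
Proof.
case=> f [f_bij fM] [Q [c [Qu c0 QE]]].
(* The scalar s = c / det Q solves s^2 c = s^3 det Q, so the congruence factor becomes the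
   determinant of [P]. *)
pose P := (c / \det Q) *: Q.
have dQ : \det Q != 0 by rewrite -unitfE -unitmxE.
have PE : P^T *m M *m P = \det P *: N.
  rewrite /P detZ -scalemxAr [(_ *: Q)^T]linearZ /= -!scalemxAl QE.
  rewrite !scalerA; congr (_ *: _).
  by field.
have Pu : P \in unitmx 
  by rewrite unitmxE detZ unitfE mulf_neq0 ?expf_neq0 ?mulf_neq0 ?invr_neq0.
have dP : \det P != 0 by rewrite -unitfE -unitmxE.
exists (mulmxr P \o f); split.
  apply: bij_comp f_bij; exists (mulmx^~ (invmx P)) => x /=.
    exact: mulmxK.
  exact: mulmxKV.
move=> u v /=; rewrite fM; apply: (scalerI dP).
by rewrite [RHS]scalemxAr -PE 2!scalemxAl -cross_mulmx !mulmxA.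
Qed.

(** Together with [structure_congruent], this makes the structure matrices of an algebra, if there
    are any, exactly one congruence class. *)
Lemma structure_unique (L : lieAlgebraType F) M N :
  has_structure L M -> has_structure L N -> congruent M N.
Proof.
case=> f [[f' fK f'K] fM] [g [[g' gK g'K] gM]].
pose f'l := GRing.isLinear.Build _ _ _ _ f' (can2_linear fK f'K).
pose h : {linear 'rV[F]_3 -> L} := HB.pack f' f'l.
pose P := lin1_mx (g \o h).
have gP u : g u = f u *m P by rewrite mul_rV_lin1 /= fK.
pose g'l := GRing.isLinear.Build _ _ _ _ g' (can2_linear gK g'K).
pose k : {linear 'rV[F]_3 -> L} := HB.pack g' g'l.
have [Pu _] : P \in unitmx /\ lin1_mx (f \o k) \in unitmx.
  apply: mulmx1_unit; apply/row_matrixP => i.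
  by rewrite row1 rowE mulmxA !mul_rV_lin1 /= gK f'K.
exists P, (\det P); split=> //; first by rewrite -unitfE -unitmxE.
(* Comparing the matrices on cross products suffices, since every basis vector is one. *)
have E x y : cross x y *m (P^T *m M *m P) = cross x y *m (\det P *: N).
  rewrite -[x](mulmxKV Pu) -[y](mulmxKV Pu) !mulmxA cross_mulmx -!scalemxAl.
  rewrite -scalemxAr; congr (_ *: _).
  rewrite -[_ *m invmx P]f'K -[y *m invmx P]f'K.
  by rewrite -!gP -gM -fM gP.
apply/row_matrixP; elim/forall_ord3; rewrite !rowE.
- by have := E e2 e3; rewrite /cross skew3_e23.
- by have := E e3 e1; rewrite /cross skew3_e31.
- by have := E e1 e2; rewrite /cross skew3_e12.
Qed.

Lemma structure_isomorphic (L L' : lieAlgebraType F) M :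
  has_structure L' M -> lie_isomorphic L L' <-> has_structure L M.
Proof.
case=> g [[g' gK g'K] gM]; split=> [[f [f_bij fM]]|[f [f_bij fM]]].
  exists (g \o f); split; first by apply: bij_comp f_bij; exists g'.
  by move=> u v /=; rewrite fM gM.
pose g'l := GRing.isLinear.Build _ _ _ _ g' (can2_linear gK g'K).
pose h : {linear 'rV[F]_3 -> L'} := HB.pack g' g'l.
exists (h \o f); split; first by apply: bij_comp f_bij; exists g.
by move=> u v /=; apply: (can_inj gK); rewrite gM !g'K fM.
Qed.

End Structure.

(** * Congruence up to a nonzero factor, and diagonalization of symmetric matrices *)

Section Congruence.
Variables (F : fieldType) (n : nat).
Implicit Types M N : 'M[F]_n.

Lemma congruent_refl M : congruent M M.
Proof.
by exists 1%:M, 1; rewrite unitmx1 oner_eq0 trmx1 mul1mx mulmx1 scale1r.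
Qed.

Lemma congruent_sym M N : congruent M N -> congruent N M.
Proof.
case=> P [c [Pu c0 PE]]; exists (invmx P), c^-1; split.
- by rewrite unitmx_inv.
- by rewrite invr_eq0.
apply: (scalerI c0); rewrite scalerA mulfV // scale1r.
by rewrite scalemxAl scalemxAr -PE trmx_inv !mulmxA mulVmx ?unitmx_tr //
  mul1mx mulmxK.
Qed.

Lemma congruent_trans M N M' :
  congruent M N -> congruent N M' -> congruent M M'.
Proof.
case=> P [c [Pu c0 PE]] [Q [d [Qu d0 QE]]]; exists (P *m Q), (c * d); split.
- by rewrite unitmx_mul Pu.
- exact: mulf_neq0.
rewrite trmx_mul !mulmxA -2!(mulmxA Q^T) PE -scalemxAr -scalemxAl QE.
by rewrite scalerA.
Qed.

Lemma congruentW M P : P \in unitmx -> congruent M (P^T *m M *m P).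
Proof. by exists P, 1; rewrite oner_eq0 scale1r. Qed.

Lemma exists_unitmx_row (u v : 'rV[F]_n) :
  u != 0 -> v != 0 -> exists2 P, P \in unitmx & u *m P = v.
Proof.
move=> u0 v0; have [j uj] : exists j, u 0 j != 0 by exact/rV0Pn.
(* A nonzero entry of [u] gives a rank-one matrix taking [u] to [v]; [complete_unitmx] replaces it
   by an invertible one with the same value at [u]. *)
have uf : u *m ((u 0 j)^-1 *: (delta_mx j 0 *m v)) = v.
  rewrite -scalemxAr mulmxA -colE [col j u]mx11_scalar mxE mul_scalar_mx.
  by rewrite scalerA mulVf // scale1r.
have [|P Pu PE] := @complete_unitmx _ _ _ u ((u 0 j)^-1 *: (delta_mx j 0 *m v)).
  by rewrite uf !rank_rV u0 v0.
by exists P; rewrite // -PE.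
Qed.

End Congruence.

(** Lagrange reduction: split off a vector on which the quadratic form is nonzero, then apply
    induction to the Schur complement. *)
Lemma sym_diagonalize (F : fieldType) n (S : 'M[F]_n) :
    2 != 0 :> F -> S^T = S ->
  exists2 P, P \in unitmx & is_diag_mx (P^T *m S *m P).
Proof.
move=> two0; elim: n S => [|n IHn] S symS.
  by exists 1%:M; rewrite ?unitmx1 //; apply/is_diag_mxP => -[].
have [->|/eqP/matrix0Pn[i [j Sij]]] := S =P 0.
  by exists 1%:M; rewrite ?unitmx1 // mulmx0 mul0mx mx0_is_diag.
have E (A : 'M[F]_n.+1) k l :
    (delta_mx 0 k *m A *m (delta_mx 0 l)^T) (0 : 'I_1) (0 : 'I_1) = A k l.
  by rewrite trmx_delta -rowE -colE !mxE.
pose q (v : 'rV_n.+1) := (v *m S *m v^T) 0 0.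
have [v qv] : exists v, q v != 0.
  have [Sii|Sii] := eqVneq (S i i) 0; last by exists (delta_mx 0 i); rewrite /q E.
  have [Sjj|Sjj] := eqVneq (S j j) 0; last by exists (delta_mx 0 j); rewrite /q E.
  (* When both diagonal entries vanish, the form takes the value 2 S_ij at this sum. *)
  exists (delta_mx 0 i + delta_mx 0 j).
  rewrite /q linearD /= !mulmxDl !mulmxDr ![fun_of_matrix (_ + _) _ _]mxE.
  rewrite !E Sii Sjj add0r addr0.
  have -> : S j i = S i j by rewrite -{1}symS mxE.
  by rewrite -mulr2n -mulr_natl mulf_neq0.
have v0 : v != 0 by apply: contraNneq qv => ->; rewrite /q !mul0mx mxE.
have d0 : delta_mx 0 0 != 0 :> 'rV[F]_n.+1.
  by apply/rV0Pn; exists 0; rewrite mxE !eqxx oner_eq0.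
have [g gu gE] := exists_unitmx_row d0 v0.
have [T TE] : exists T : 'M_(1 + n), T = g *m S *m g^T by exists (g *m S *m g^T).
pose s := T 0 0.
have s0 : s != 0.
  by rewrite /s -E TE 2!mulmxA -!(mulmxA _ g^T) -trmx_mul gE.
have symT : T^T = T by rewrite TE !trmx_mul trmxK symS mulmxA.
pose B := drsubmx T; pose u := dlsubmx T.
have Tblock : T = block_mx s%:M u^T u B.
  rewrite -[LHS]submxK trmx_dlsub symT; congr block_mx.
  by rewrite [LHS]mx11_scalar !mxE; congr (T _ _)%:M; apply: val_inj.
have symB : B^T = B by rewrite /B trmx_drsub symT.
have [|Q Qu Qd] := IHn (B - s^-1 *: (u *m u^T)).
  by rewrite linearB linearZ /= trmx_mul trmxK symB.
(* [X] clears the entries next to the pivot [s]; [Y] then applies the inductive change of basis to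
   the Schur complement. *)
pose X : 'M_(1 + n) := block_mx 1%:M 0 (- s^-1 *: u) 1%:M.
pose Y : 'M_(1 + n) := block_mx 1%:M 0 0 Q^T.
have Xu : X \in unitmx by rewrite unitmxE det_lblock !det1 mulr1 unitr1.
have Yu : Y \in unitmx by rewrite unitmxE det_lblock det1 mul1r -unitmxE unitmx_tr.
exists (Y *m X *m g)^T; first by rewrite unitmx_tr !unitmx_mul Yu Xu.
rewrite trmxK; suff -> : Y *m X *m g *m S *m (Y *m X *m g)^T =
    block_mx s%:M 0 0 (Q^T *m (B - s^-1 *: (u *m u^T)) *m Q).
  by rewrite (@is_diag_block_mx _ 1 n 1 n) // Qd scalar_mx_is_diag !eqxx.
transitivity (Y *m (X *m T *m X^T) *m Y^T).
  by rewrite TE !trmx_mul !mulmxA.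
have -> : X *m T *m X^T = block_mx s%:M 0 0 (B - s^-1 *: (u *m u^T)).
  rewrite Tblock tr_block_mx !mulmx_block !(trmx0, trmx1, mul1mx, mulmx1).
  rewrite !(mul0mx, mulmx0, addr0, add0r) mul_mx_scalar scalerA mulrN mulfV //.
  rewrite scaleN1r addNr mul0mx add0r linearZ /= -scalemxAr.
  rewrite mul_scalar_mx scalerA mulNr mulVf // scaleN1r addNr.
  by rewrite scaleNr mulNmx -scalemxAl addrC.
rewrite tr_block_mx !mulmx_block !(trmx0, trmx1, mul1mx, mulmx1) trmxK.
by rewrite !(mul0mx, mulmx0, addr0, add0r).
Qed.

(** The skew part has axial vector -2h [e3], so the Jacobi identity becomes 2 h n3 = 0. *)
Definition bianchi_mx (F : comNzRingType) (n1 n2 n3 h : F) : 'M[F]_3 :=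
  mx3 n1 (- h) 0 h n2 0 0 0 n3.

(** * Reduction to normal form over a field *)

Section NormalForm.
Variable F : fieldType.
Implicit Types (n p q r c h : F) (M : 'M[F]_3).

(** The change of basis is diagonal. It multiplies the diagonal by squares but [h] by pq, so the
    signs of p and q affect [h] alone. *)
Lemma congruent_bianchi_mx p q r c n1 n2 n3 h m1 m2 m3 k :
    p != 0 -> q != 0 -> r != 0 -> c != 0 ->
    p ^+ 2 * n1 = c * m1 -> q ^+ 2 * n2 = c * m2 -> r ^+ 2 * n3 = c * m3 ->
    p * q * h = c * k ->
  congruent (bianchi_mx n1 n2 n3 h) (bianchi_mx m1 m2 m3 k).
Proof.
move=> p0 q0 r0 c0 E1 E2 E3 E4; exists (mx3 p 0 0 0 q 0 0 0 r), c; split=> //.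
  rewrite unitmxE det_mx3 !mxE /= unitfE.
  by rewrite !(mulr0, mul0r, subr0, addr0) !mulf_neq0.
apply/matrixP; do 2![elim/forall_ord3];
  rewrite !mxE !sum_ord3 !mxE !sum_ord3 !mxE /= ?mulrN -?E1 -?E2 -?E3 -?E4; ring.
Qed.

Lemma bianchi_mx_swap12 n1 n2 n3 h :
  congruent (bianchi_mx n1 n2 n3 h) (bianchi_mx n2 n1 n3 (- h)).
Proof.
exists (mx3 0 1 0 1 0 0 0 0 1), 1; split; rewrite ?oner_eq0 //.
  rewrite unitmxE det_mx3 !mxE /= (_ : _ + _ = -1); last by ring.
  exact: unitrN1.
apply/matrixP; do 2![elim/forall_ord3];
  rewrite !mxE !sum_ord3 !mxE !sum_ord3 !mxE /=; ring.
Qed.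

Lemma bianchi_mx_swap13 n1 n2 n3 :
  congruent (bianchi_mx n1 n2 n3 0) (bianchi_mx n3 n2 n1 0).
Proof.
exists (mx3 0 0 1 0 1 0 1 0 0), 1; split; rewrite ?oner_eq0 //.
  rewrite unitmxE det_mx3 !mxE /= (_ : _ + _ = -1); last by ring.
  exact: unitrN1.
apply/matrixP; do 2![elim/forall_ord3];
  rewrite !mxE !sum_ord3 !mxE !sum_ord3 !mxE /=; ring.
Qed.

(** The vectors (p, r) and (q, t) form an orthogonal basis for a x^2 + s x y + d y^2. If a or d is
    nonzero, Gram-Schmidt gives one; otherwise the form is s x y, and (1, 1), (1, -1) will do. *)
Lemma diag_binary_form a s d : 2 != 0 :> F ->
  exists p q r t,
    p * t - q * r != 0 /\
    2 * a * p * q + s * (p * t + q * r) + 2 * d * r * t = 0.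
Proof.
move=> two0; have [->|a0] := eqVneq a 0; last first.
  exists 1, (- s / (2 * a)), 0, 1; split; first by rewrite mulr0 subr0 mulr1 oner_eq0.
  by field; apply/andP.
have [->|d0] := eqVneq d 0; last first.
  exists 1, 0, (- s / (2 * d)), 1; split; first by rewrite mul0r subr0 mulr1 oner_eq0.
  by field; apply/andP.
exists 1, 1, 1, (-1); split; last by ring.
by rewrite mul1r mulr1 -opprD oppr_eq0.
Qed.

Lemma congruent_planar M :
    2 != 0 :> F -> M^T != M -> axial M *m M = 0 ->
  exists n1 n2 h, congruent M (bianchi_mx n1 n2 0 h).
Proof.
rewrite -axial_eq0 => two0 w0 wM.
(* With w also in the right kernel, taking it as third basis vector kills both the third row and the
   third column. *)
have Mw : M *m (axial M)^T = 0 by rewrite axial_skew -trmx_mul wM trmx0.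
have d0 : e3 != 0 :> 'rV[F]_3 by apply/rV0Pn; exists 2; rewrite mxE !eqxx oner_eq0.
have [g gu gE] := exists_unitmx_row d0 w0.
have [N NE] : exists N : 'M_3, N = g *m M *m g^T by exists (g *m M *m g^T).
have congN : congruent M N by rewrite NE -{1}[g]trmxK; apply: congruentW; rewrite unitmx_tr.
have N2 i : N 2 i = 0.
  have : row 2 N = 0 by rewrite NE rowE !mulmxA gE wM mul0mx.
  by move/rowP/(_ i); rewrite !mxE.
have N_2 i : N i 2 = 0.
  have : col 2 N = 0.
    rewrite NE colE -!mulmxA (_ : delta_mx 2 0 = e3^T); last by rewrite trmx_delta.
    by rewrite -trmx_mul gE Mw mulmx0.
  by move/colP/(_ i); rewrite !mxE.
(* The form is that of the symmetric part of the upper left block; orthogonality says that the new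
   off-diagonal entries are opposite. *)
have [p [q [r [t [dP sP]]]]] := diag_binary_form (N 0 0) (N 0 1 + N 1 0) (N 1 1) two0.
pose P := mx3 p q 0 r t 0 0 0 1.
have Pu : P \in unitmx.
  by rewrite unitmxE det_mx3 !mxE /= unitfE !(mulr0, mul0r, subr0, addr0, mulr1).
pose N' := P^T *m N *m P.
exists (N' 0 0), (N' 1 1), (N' 1 0); apply: congruent_trans congN _.
suff <- : N' = bianchi_mx (N' 0 0) (N' 1 1) 0 (N' 1 0) by apply: congruentW.
have N'01 : N' 0 1 = - N' 1 0.
  apply/eqP; rewrite -addr_eq0 -sP /N' !mxE !sum_ord3 !mxE !sum_ord3 !mxE /=.
  by rewrite !(N2, N_2); apply/eqP; ring.
have N'2 i : N' 2 i = 0.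
  rewrite /N' !mxE !sum_ord3 !mxE !sum_ord3 !mxE /= !(N2, N_2); ring.
have N'_2 i : N' i 2 = 0.
  rewrite /N' !mxE !sum_ord3 !mxE !sum_ord3 !mxE /= !(N2, N_2); ring.
apply/matrixP; do 2![elim/forall_ord3]; by rewrite [RHS]mxE.
Qed.

(** The axial vector represents the trace of ad up to sign, so symmetric matrices belong to
    unimodular algebras. *)
Lemma congruent_unimodular M :
    2 != 0 :> F -> M^T = M ->
  exists n1 n2 n3, congruent M (bianchi_mx n1 n2 n3 0).
Proof.
move=> two0 symM; have [P Pu /is_diag_mxP Pd] := sym_diagonalize two0 symM.
pose D := P^T *m M *m P; exists (D 0 0), (D 1 1), (D 2 2).
suff <- : D = bianchi_mx (D 0 0) (D 1 1) (D 2 2) 0 by apply: congruentW.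
by apply/matrixP; do 2![elim/forall_ord3]; rewrite [RHS]mxE /= ?oppr0 //; apply: Pd.
Qed.
End NormalForm.

(** * Congruence invariants: ranks of the symmetric and skew parts *)

Section Invariants.
Variable F : fieldType.

Lemma mxrank_diag n (d : 'rV[F]_n) : \rank (diag_mx d) = (\sum_i (d 0 i != 0)%R)%N.
Proof.
elim: n d => [|n IHn] d; first by rewrite [diag_mx d]flatmx0 mxrank0 big_ord0.
transitivity (\rank (diag_mx
    (row_mx (lsubmx (d : 'rV_(1 + n))) (rsubmx (d : 'rV_(1 + n)))))).
  by rewrite hsubmxK.
rewrite diag_mx_row rank_diag_block_mx IHn [RHS]big_ord_recl; congr (_ + _)%N.
  rewrite [diag_mx _]mx11_scalar !mxE eqxx mulr1n rank_rV.
  rewrite (_ : lshift n 0 = ord0); last exact: val_inj.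
  congr (~~ _ : nat); apply/eqP/eqP => [/matrixP/(_ 0 0)|->]; last exact: raddf0.
  by rewrite !mxE eqxx mulr1n.
by apply: eq_bigr => i _; rewrite mxE; congr (d _ _ != 0 : nat); apply: val_inj.
Qed.
Lemma congruent_rank n (M N : 'M[F]_n) : congruent M N -> \rank M = \rank N.
Proof.
case=> P [c [Pu c0 PE]]; rewrite -(mxrank_scale_nz N c0) -PE.
rewrite mxrankMfree ?row_free_unit // -[RHS]mxrank_tr trmx_mul trmxK.
by rewrite mxrankMfree ?row_free_unit // mxrank_tr.
Qed.

(** The same [P] and [c] serve for the transposes. The values a = 1 and a = -1 give twice the
    symmetric and skew parts. *)
Lemma congruentDtr n (M N : 'M[F]_n) a :
  congruent M N -> congruent (M + a *: M^T) (N + a *: N^T).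
Proof.
case=> P [c [Pu c0 PE]]; exists P, c; split=> //.
have PET : P^T *m M^T *m P = c *: N^T.
  by rewrite -[c *: N^T]linearZ -PE /= !trmx_mul trmxK mulmxA.
by rewrite mulmxDr mulmxDl PE -scalemxAr -scalemxAl PET scalerDr !scalerA (mulrC a).
Qed.

Lemma bianchi_mx_rank_sym (n1 n2 n3 h : F) : 2 != 0 :> F ->
  \rank (bianchi_mx n1 n2 n3 h + 1 *: (bianchi_mx n1 n2 n3 h)^T)%R
    = ((n1 != 0)%R + (n2 != 0)%R + (n3 != 0)%R)%N.
Proof.
move=> two0; have -> : bianchi_mx n1 n2 n3 h + 1 *: (bianchi_mx n1 n2 n3 h)^T
    = diag_mx (\row_i [:: 2 * n1; 2 * n2; 2 * n3]`_i); last first.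
  by rewrite mxrank_diag sum_ord3 !mxE /= !mulf_eq0 (negPf two0).
by apply/matrixP; do 2![elim/forall_ord3]; rewrite !mxE /=; ring.
Qed.

Lemma bianchi_mx_rank_skew (n1 n2 n3 h : F) : 2 != 0 :> F ->
  (\rank (bianchi_mx n1 n2 n3 h + -1 *: (bianchi_mx n1 n2 n3 h)^T)%R == 0%N)
    = (h == 0).
Proof.
move=> two0; rewrite mxrank_eq0; apply/eqP/eqP => [/matrixP/(_ 1 0)|->].
  rewrite !mxE /= mulrN mulN1r opprK -mulr2n -mulr_natl => /eqP.
  by rewrite mulf_eq0 (negPf two0) => /eqP.
by apply/matrixP; do 2![elim/forall_ord3]; rewrite !mxE /=; ring.
Qed.

End Invariants.

Definition structure_mx (R : realType) (t : bianchi_type R) : 'M[R]_3 :=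
  match t with
  | BianchiI => bianchi_mx 0 0 0 0
  | BianchiII => bianchi_mx 1 0 0 0
  | BianchiIV => bianchi_mx 1 0 0 1
  | BianchiV => bianchi_mx 0 0 0 1
  | BianchiVI h _ => bianchi_mx 1 (-1) 0 h
  | BianchiVII h _ => bianchi_mx 1 1 0 h
  | BianchiVIII => bianchi_mx 1 1 (-1) 0
  | BianchiIX => bianchi_mx 1 1 1 0
  end.

(** * Classification over the reals *)

Section Classification.
Variable R : realType.
Implicit Types (n h : R) (t : bianchi_type R).

Lemma bianchi_bracketE t (x y : 'rV[R]_3) :
  bianchi_bracket t x y = cross x y *m structure_mx t.
Proof.
rewrite -skew3_cross; case: t => [||||h h0|h h0||] /=;
  by congr skew3; apply/rowP; elim/forall_ord3; rewrite !mxE /=; ring.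
Qed.

Lemma bianchi_structure t : has_structure (bianchi t) (structure_mx t).
Proof.
pose f (x : bianchi t) : 'rV[R]_3 := x.
have f_lin : linear f by [].
pose g : {linear bianchi t -> 'rV[R]_3} :=
  HB.pack f (GRing.isLinear.Build _ _ _ _ f f_lin).
exists g; split=> [|u v]; first by exists (fun x => x).
exact: bianchi_bracketE.
Qed.

Lemma unit_scaling n : n != 0 -> exists2 p, p != 0 & p ^+ 2 * n = Num.sg n.
Proof.
move=> n0; exists (Num.sqrt `|n|)^-1.
  by rewrite invr_eq0 gt_eqF // sqrtr_gt0 normr_gt0.
by rewrite exprVn sqr_sqrtr // {2}[n]numEsg mulrCA mulVf ?mulr1 ?normr_eq0.
Qed.

Lemma sgr_cases n : n != 0 -> Num.sg n = 1 \/ Num.sg n = -1.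
Proof. by case: sgrP => // _ _; [left|right]. Qed.

Lemma exists_type_planar n1 n2 h :
  exists t, congruent (bianchi_mx n1 n2 0 h) (structure_mx t).
Proof.
have line n k : n != 0 ->
    exists t, congruent (bianchi_mx n 0 0 k) (structure_mx t).
  move=> n0; have [->|k0] := eqVneq k 0.
    exists (BianchiII R); apply: (@congruent_bianchi_mx _ 1 1 1 n);
      rewrite ?oner_eq0 //; ring.
  (* Scaling the second vector by n / k turns the skew entry into n, which the factor n then
     removes. *)
  exists (BianchiIV R); apply: (@congruent_bianchi_mx _ 1 (n / k) 1 n);
    rewrite ?oner_eq0 ?mulf_neq0 ?invr_eq0 //; by field.
have [->|n10] := eqVneq n1 0.
  have [->|n20] := eqVneq n2 0.
    have [->|h0] := eqVneq h 0.
      exists (BianchiI R); exact: congruent_refl.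
    exists (BianchiV R); apply: (@congruent_bianchi_mx _ 1 1 1 h);
      rewrite ?oner_eq0 //; ring.
  have [t tP] := line n2 (- h) n20.
  by exists t; apply: congruent_trans tP; apply: bianchi_mx_swap12.
have [->|n20] := eqVneq n2 0; first exact: line.
have [[p p0 pE] [q q0 qE]] := (unit_scaling n10, unit_scaling n20).
have flip e k : congruent (bianchi_mx 1 e 0 k) (bianchi_mx 1 e 0 (- k)).
  by apply: (@congruent_bianchi_mx _ 1 (-1) 1 1); rewrite ?oppr_eq0 ?oner_eq0 //; ring.
have [e eE [k]] : exists2 e, e = 1 \/ e = -1 :> R & exists k,
    congruent (bianchi_mx n1 n2 0 h) (bianchi_mx 1 e 0 k).
  have [s1 s2] := (sgr_cases n10, sgr_cases n20).
  (* Dividing by the sign of [n1] makes the first entry 1, leaving the product of the signs in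
     second place: 1 leads to VII and -1 to VI. *)
  exists (Num.sg n1 * Num.sg n2).
    by case: s1 => ->; case: s2 => ->;
      rewrite ?mulrNN ?mulN1r ?mul1r ?mulr1; [left|right|right|left].
  exists (Num.sg n1 * (p * q * h)).
  have ss : Num.sg n1 * Num.sg n1 = 1 by case: s1 => ->; rewrite ?mulrNN mulr1.
  apply: (@congruent_bianchi_mx _ p q 1 (Num.sg n1)); rewrite ?sgr_eq0 ?oner_eq0 //.
  - by rewrite mulr1.
  - by rewrite mulrA ss mul1r.
  - by rewrite !mulr0.
  - by rewrite mulrA ss mul1r.
case: eE => -> {e} congk.
  have [k0|/ltW k0] := leP 0 k; first by exists (BianchiVII k0).
  have k0' : 0 <= - k by rewrite oppr_ge0.
  by exists (BianchiVII k0'); apply: congruent_trans congk _; apply: flip.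
have [k0|/ltW k0] := leP k 0; first by exists (BianchiVI k0).
have k0' : - k <= 0 by rewrite oppr_le0.
by exists (BianchiVI k0'); apply: congruent_trans congk _; apply: flip.
Qed.

Lemma exists_type_unimodular n1 n2 n3 :
  exists t, congruent (bianchi_mx n1 n2 n3 0) (structure_mx t).
Proof.
(* A vanishing diagonal entry is moved to third place, which gives the planar case with h = 0. *)
have [->|n30] := eqVneq n3 0; first exact: exists_type_planar.
have [->|n10] := eqVneq n1 0.
  have [t tP] := exists_type_planar n3 n2 0.
  by exists t; apply: congruent_trans tP; apply: bianchi_mx_swap13.
have swap12 a b c :
    congruent (bianchi_mx a b c 0) (bianchi_mx b a c 0 : 'M[R]_3).
  by rewrite -{2}oppr0; apply: bianchi_mx_swap12.
have [->|n20] := eqVneq n2 0.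
  have [t tP] := exists_type_planar n3 n1 0.
  exists t; apply: congruent_trans tP; apply: congruent_trans (swap12 _ _ _) _.
  exact: bianchi_mx_swap13.
have opp a b c :
    congruent (bianchi_mx a b c 0) (bianchi_mx (- a) (- b) (- c) 0 : 'M[R]_3).
  by apply: (@congruent_bianchi_mx _ 1 1 1 (-1)); rewrite ?oppr_eq0 ?oner_eq0 //; ring.
have [[p p0 pE] [q q0 qE] [r r0 rE]] :=
  And3 (unit_scaling n10) (unit_scaling n20) (unit_scaling n30).
suff [t tP] : exists t,
    congruent (bianchi_mx (Num.sg n1) (Num.sg n2) (Num.sg n3) 0) (structure_mx t).
  exists t; apply: congruent_trans tP.
  by apply: (@congruent_bianchi_mx _ p q r 1); rewrite ?oner_eq0 ?mul1r ?mulr0.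
have VIII : exists t, congruent (bianchi_mx 1 1 (-1) 0) (structure_mx t).
  by exists (BianchiVIII R); apply: congruent_refl.
have IX : exists t, congruent (bianchi_mx 1 1 1 0) (structure_mx t).
  by exists (BianchiIX R); apply: congruent_refl.
have step M N : congruent M N -> (exists t, congruent N (structure_mx t)) ->
    exists t, congruent M (structure_mx t).
  by move=> MN [t Nt]; exists t; apply: congruent_trans Nt.
(* Up to permutation and a global sign, equal signs give IX and mixed signs give VIII. *)
case: (sgr_cases n10) => ->; case: (sgr_cases n20) => ->;
  case: (sgr_cases n30) => -> //.
- by apply: (step _ _ (swap12 _ _ _)); apply: (step _ _ (bianchi_mx_swap13 _ _ _)).
- apply: (step _ _ (opp _ _ _)); apply: (step _ _ (bianchi_mx_swap13 _ _ _)).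
  by rewrite opprK.
- exact: (step _ _ (bianchi_mx_swap13 _ _ _)).
- apply: (step _ _ (opp _ _ _)); rewrite opprK; apply: (step _ _ (swap12 _ _ _)).
  exact: (step _ _ (bianchi_mx_swap13 _ _ _)).
- by apply: (step _ _ (opp _ _ _)); rewrite opprK.
- by apply: (step _ _ (opp _ _ _)); rewrite opprK.
Qed.

Lemma exists_type (M : 'M[R]_3) :
  axial M *m M = 0 -> exists t, congruent M (structure_mx t).
Proof.
move=> wM; have two0 : 2 != 0 :> R by rewrite pnatr_eq0.
have [symM|asymM] := eqVneq M^T M.
  have [n1 [n2 [n3 MN]]] := congruent_unimodular two0 symM.
  have [t tP] := exists_type_unimodular n1 n2 n3.
  by exists t; apply: congruent_trans tP.
have [n1 [n2 [h MN]]] := congruent_planar two0 asymM wM.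
have [t tP] := exists_type_planar n1 n2 h.
by exists t; apply: congruent_trans tP.
Qed.

(** Let D = ps - qr be the determinant of the block of [P]. The symmetric parts give D^2 = e e' c^2
    and the skew parts give D h = c h'; positivity of squares excludes e' = -e. *)
Lemma congruent_planar_invariants e e' h h' :
    e ^+ 2 = 1 -> e' ^+ 2 = 1 ->
  congruent (bianchi_mx 1 e 0 h) (bianchi_mx 1 e' 0 h') ->
  e = e' /\ h ^+ 2 = h' ^+ 2.
Proof.
move=> ee ee' [P [c [_ c0 /matrixP PE]]].
have := (PE 0 0, PE 1 1, PE 0 1, PE 1 0).
rewrite !(mxE, sum_ord3) /=.
move: (P 0 0) (P 0 1) (P 1 0) (P 1 1) (P 2 0) (P 2 1) => p q r s x y.
case=> -[[E1 E2] E3 E4].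
have F1 : p ^+ 2 + e * r ^+ 2 = c by lra.
have F2 : q ^+ 2 + e * s ^+ 2 = c * e' by lra.
have F3 : p * q + e * r * s = 0 by lra.
have F4 : h * (p * s - q * r) = c * h' by lra.
(* Brahmagupta's identity: (p^2 + e r^2)(q^2 + e s^2) = (pq + e r s)^2 + e (ps - qr)^2. *)
have D2 : (p * s - q * r) ^+ 2 = (e * e') * c ^+ 2.
  transitivity (e * (c * (c * e')) - e * (p * q + e * r * s) ^+ 2).
    rewrite -[LHS]mul1r -ee -{1}F1 -F2; ring.
  by rewrite F3; ring.
have cc : 0 < c ^+ 2 by rewrite exprn_even_gt0.
have /eqP : (e * e') ^+ 2 = 1 by rewrite exprMn ee ee' mulr1.
rewrite sqrf_eq1 => /orP[] /eqP eE; last first.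
  have := sqr_ge0 (p * s - q * r).
  by rewrite D2 eE mulN1r oppr_ge0 leNgt cc.
split; first by rewrite -[LHS]mulr1 -ee' mulrA eE mul1r.
have c20 : c ^+ 2 != 0 by rewrite gt_eqF.
apply: (mulfI c20); rewrite -[RHS]exprMn -F4 exprMn D2 eE; ring.
Qed.

Lemma not_congruent_VIII_IX :
  ~ congruent (structure_mx (BianchiVIII R)) (structure_mx (BianchiIX R)).
Proof.
case=> P [c [Pu c0 PE]].
have IX1 : structure_mx (BianchiIX R) = 1%:M.
  by apply/matrixP; do 2![elim/forall_ord3]; rewrite !mxE ?oppr0.
have inv : P^T *m structure_mx (BianchiVIII R) *m (c^-1 *: P) = 1%:M.
  by rewrite -scalemxAr PE IX1 scalerA mulVf // scale1r.
(* Commuting the inverse factors brings out the Gram matrix of the rows of [P]. Its diagonal is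
   nonnegative, so entries (0, 0) and (2, 2) force c >= 0 and c <= 0. *)
have /matrixP PPN : P *m P^T *m structure_mx (BianchiVIII R) = c%:M.
  have := mulmx1C inv; rewrite -scalemxAl mulmxA => /(congr1 ( *:%R c)).
  by rewrite scalerA mulfV // scale1r scalemx1.
have := (PPN 0 0, PPN 2 2); rewrite !(mxE, sum_ord3) /=.
case=> E0 E2; move/eqP: c0; apply.
have := sqr_ge0 (P 0 0); have := sqr_ge0 (P 0 1); have := sqr_ge0 (P 0 2).
have := sqr_ge0 (P 2 0); have := sqr_ge0 (P 2 1); have := sqr_ge0 (P 2 2).
lra.
Qed.

Lemma structure_mx_inj t t' :
  congruent (structure_mx t) (structure_mx t') -> t = t'.
Proof.
move=> tt'; have two0 : 2 != 0 :> R by rewrite pnatr_eq0.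
(* The rank of the symmetric part and the vanishing of the skew part separate all types except VI
   from VII, VIII from IX, and members of one series. *)
have := congruent_rank (congruentDtr 1 tt').
have := congr1 (fun k => k == 0%N) (congruent_rank (congruentDtr (-1) tt')).
have N11 : (-1) ^+ 2 = 1 :> R by rewrite sqrrN expr1n.
have N1 : 1 <> -1 :> R by lra.
(* Within a series the invariant is h^2, and the sign condition recovers h. *)
have eqVI (h k : R) (h0 : h <= 0) (k0 : k <= 0) :
    h ^+ 2 = k ^+ 2 -> BianchiVI h0 = BianchiVI k0.
  move/eqP; rewrite eqf_sqr => hk; have {hk} hk : h = k.
    by case/orP: hk => /eqP; lra.
  by case: k / hk k0 => k0; congr BianchiVI; apply: bool_irrelevance.
have eqVII (h k : R) (h0 : 0 <= h) (k0 : 0 <= k) :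
    h ^+ 2 = k ^+ 2 -> BianchiVII h0 = BianchiVII k0.
  move/eqP; rewrite eqf_sqr => hk; have {hk} hk : h = k.
    by case/orP: hk => /eqP; lra.
  by case: k / hk k0 => k0; congr BianchiVII; apply: bool_irrelevance.
case: t tt' => [||||h h0|h h0||]; case: t' => [||||k k0|k k0||] tt' /=;
  rewrite !bianchi_mx_rank_sym // !bianchi_mx_rank_skew //
    ?oppr_eq0 oner_eq0 eqxx //=.
- by move=> _ _; apply: eqVI; have [] := congruent_planar_invariants N11 N11 tt'.
- by have [/esym/N1] := congruent_planar_invariants N11 (expr1n _ _) tt'.
- by have [/N1] := congruent_planar_invariants (expr1n _ _) N11 tt'.
- by move=> _ _; apply: eqVII;
    have [] := congruent_planar_invariants (expr1n _ _) (expr1n _ _) tt'.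
- by have := not_congruent_VIII_IX tt'.
- by have := not_congruent_VIII_IX (congruent_sym tt').
Qed.

End Classification.

Theorem theorem2p4 (R : realType) (L : lieVectType R) (dimL : \dim {:L} = 3%N) :
  exists! t : bianchi_type R, lie_isomorphic L (bianchi t).
Proof.
have [M LM] := exists_structure dimL.
have [t Mt] := exists_type (axial_structure LM).
have Lt : has_structure L (structure_mx t) := structure_congruent LM Mt.
exists t; split.
  exact/(structure_isomorphic _ (bianchi_structure t)).
move=> t' /(structure_isomorphic _ (bianchi_structure t')) Lt'.
exact: structure_mx_inj (structure_unique Lt Lt').
Qed.
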